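(* Let $\mathcal{E}$ be a finite-dimensional Euclidean space and let $L_i:\mathcal{E}\to\mathcal{E}$ ($i=1,\ldots,n$) be nonexpansive, closed operators such that $\bigcap_{i=1}^n \mathrm{Fix}\,L_i\neq\emptyset$. Let $\Phi$ be a consistent error bound function for the sets $\mathrm{Fix}\,L_i$ ($i=1,\dots,n$), let $B\subseteq\mathcal{E}$ be a bounded set, and suppose that: (i) for any $b>0$ there exists some $\theta_b\in[0,1]$ such that $\Phi(\cdot,b)|_{(0,a]}\in \mathrm{RV}^0_{\theta_b}$ for some $a>0$; (ii) each $L_i$ is Karamata regular over $B$. Then the following hold. (a) The operators $L_1,\ldots,L_n$ are jointly Karamata regular over $B$. (b) Let $\Gamma_B^i$ be a regularity function for $L_i$ over $B$ and assume that $\Gamma_B^i|_{(0,a]}\in\mathrm{RV}^0_{\rho_i}$ (for some $a>0$), $i=1,\ldots,n$. Let $b>0$ be such that $B\subseteq\{x\in\mathcal{E}\mid \|x\|\le b\}$, and put $\Theta_B(\cdot):=\Phi(\cdot,b)$ and $\Gamma_B:=\sum_{i=1}^n\Gamma_B^i$. Then the function $\psi_B:=\Theta_B\circ\Gamma_B$ satisfies $$\mathrm{dist}\Big(x,\bigcap_{i=1}^n \mathrm{Fix}\,L_i\Big)\le \psi_B\Big(\max_{1\le i\le n}\|x-L_i(x)\|\Big)\quad \forall x\in B,$$ and $\psi_B|_{(0,a]}\in\mathrm{RV}^0_\rho$ (for some $a>0$) with $\rho=\theta_b\min_{1\le i\le n}\rho_i$.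
   Context: $\mathrm{Fix}\,L=\{x\mid L(x)=x\}$. Regular variation at $0$: a Lebesgue measurable function $f:(0,a]\to(0,\infty)$ belongs to $\mathrm{RV}^0_\rho$ ($\rho\in\mathbb{R}$) if $\lim_{x\to0_+} f(\lambda x)/f(x)=\lambda^\rho$ for all $\lambda>0$. Only the behaviour near $0$ matters. Consistent error bound function: for closed convex sets $C_1,\ldots,C_n\subseteq\mathcal{E}$ with nonempty intersection, this is a function $\Phi:\mathbb{R}_+^2\to\mathbb{R}_+$ that is nondecreasing in each variable, satisfies $\lim_{a\to0_+}\Phi(a,b)=\Phi(0,b)=0$ for all $b\ge0$, and $\mathrm{dist}(x,\bigcap_{i=1}^n C_i)\le\Phi(\max_{1\le i\le n}\mathrm{dist}(x,C_i),\|x\|)$ for all $x\in\mathcal{E}$. Joint Karamata regularity: operators $L_1,\ldots,L_n:\mathcal{E}\to\mathcal{E}$ with $C:=\bigcap_{i=1}^n\mathrm{Fix}\,L_i\ne\emptyset$ are jointly Karamata regular over a bounded set $B$ if there is a function $\psi_B:\mathbb{R}_+\to\mathbb{R}_+$ (called a regularity function for the $L_i$'s over $B$) such that: (1) $\mathrm{dist}(x,C)\le\psi_B(\max_{1\le i\le n}\|x-L_i(x)\|)$ for all $x\in B$; (2) $\psi_B$ is nondecreasing with $\lim_{t\to0_+}\psi_B(t)=\psi_B(0)=0$; (3) for some $a>0$, $\psi_B|_{(0,a]}\in\mathrm{RV}^0_\rho$ for some $\rho\in[0,1]$. For $n=1$ one says ''Karamata regular''. *)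

(* Defs.v *)
From mathcomp Require Import all_boot all_order all_algebra.
From mathcomp Require Import all_classical all_reals all_analysis.

Set Implicit Arguments.
Unset Strict Implicit.
Unset Printing Implicit Defensive.

Import Order.TTheory GRing.Theory Num.Theory.
Import numFieldNormedType.Exports.

Local Open Scope classical_set_scope.
Local Open Scope ring_scope.

(* Families are indexed by 'I_n.+1, i.e. they are nonempty, so that maxima and
   minima over the index set are genuine: the initial value of the big
   operator is one of the values of the family. *)
Definition max_ord (R : realType) (n : nat) (f : 'I_n.+1 -> R) : R :=
  \big[Num.max/f ord0]_(i < n.+1) f i.

Definition min_ord (R : realType) (n : nat) (f : 'I_n.+1 -> R) : R :=
  \big[Num.min/f ord0]_(i < n.+1) f i.

(* A Euclidean space is a finite-dimensional real vector space E together with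
   an arbitrary inner product ip. *)
Section Euclidean.
Context {R : realType} {E : vectType R} (ip : {dot E for idfun}).

Definition enorm (x : E) : R := Num.sqrt (ip x x).

(* By the convention inf set0 = 0 this is only meaningful for nonempty C. *)
Definition dist_to (x : E) (C : set E) : R := inf [set enorm (x - y) | y in C].

Definition ebounded (B : set E) : Prop :=
  exists M : R, forall x, B x -> enorm x <= M.

Definition fixed_points (L : E -> E) : set E := [set x | L x = x].

Definition common_fix (n : nat) (L : 'I_n -> E -> E) : set E :=
  \bigcap_(i in [set: 'I_n]) fixed_points (L i).

Definition nonexpansive (L : E -> E) : Prop :=
  forall x y, enorm (L x - L y) <= enorm (x - y).

(* The graph of L is closed. *)
Definition closed_operator (L : E -> E) : Prop :=
  forall (u : nat -> E) (x y : E),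
    enorm (u k - x) @[k --> \oo] --> (0 : R) ->
    enorm (L (u k) - y) @[k --> \oo] --> (0 : R) ->
    L x = y.

End Euclidean.

(* R with the sigma-algebra of Lebesgue measurable sets: the Caratheodory
   measurable sets of the outer measure induced by interval length. *)
Notation lebesgueTypeR R := (caratheodory_type (@wlength R idfun)^*%mu).

Definition lebesgue_measurable_fun (R : realType) (D : set R) (f : R -> R) :
    Prop :=
  measurable_fun (D : set (lebesgueTypeR R)) (f : lebesgueTypeR R -> R).

(* The restriction of f to ]0, a] is in RV^0_rho. Values of f outside ]0, a]
   are irrelevant to the limit, since l * x <= a for small x > 0. *)
Definition RV0_on (R : realType) (a rho : R) (f : R -> R) : Prop :=
  [/\ forall x, 0 < x <= a -> 0 < f x,
      lebesgue_measurable_fun `]0, a] f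
    & forall l : R, 0 < l -> f (l * x) / f x @[x --> 0^'+] --> l `^ rho].

Definition RV0 (R : realType) (rho : R) (f : R -> R) : Prop :=
  exists2 a : R, 0 < a & RV0_on a rho f.

(* Functions on the nonnegative half-line (or quadrant) are total functions on
   R (or R * R) that are only constrained at nonnegative arguments. *)

(* The sets C i are meant to be closed and convex with a common point; this is
   automatic for fixed point sets of nonexpansive operators with a common
   fixed point. *)
Definition consistent_error_bound (R : realType) (E : vectType R)
    (ip : {dot E for idfun}) (n : nat) (C : 'I_n.+1 -> set E)
    (Phi : R -> R -> R) : Prop :=
  [/\ forall a b, 0 <= a -> 0 <= b -> 0 <= Phi a b,
      forall a a' b, 0 <= a <= a' -> 0 <= b -> Phi a b <= Phi a' b,
      forall a b b', 0 <= a -> 0 <= b <= b' -> Phi a b <= Phi a b',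
      forall b, 0 <= b ->
        Phi a b @[a --> 0^'+] --> (0 : R) /\ Phi 0 b = 0
    & forall x, dist_to ip x (\bigcap_(i in [set: 'I_n.+1]) C i) <=
        Phi (max_ord (fun i => dist_to ip x (C i))) (enorm ip x)].

Definition regularity_function (R : realType) (E : vectType R)
    (ip : {dot E for idfun}) (n : nat) (L : 'I_n.+1 -> E -> E) (B : set E)
    (psi : R -> R) : Prop :=
  [/\ forall t, 0 <= t -> 0 <= psi t,
      forall x, B x -> dist_to ip x (common_fix L) <=
        psi (max_ord (fun i => enorm ip (x - L i x))),
      forall s t, 0 <= s <= t -> psi s <= psi t,
      psi t @[t --> 0^'+] --> (0 : R) /\ psi 0 = 0
    & exists2 rho : R, 0 <= rho <= 1 & RV0 rho psi].

Definition jointly_Karamata_regular (R : realType) (E : vectType R)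
    (ip : {dot E for idfun}) (n : nat) (L : 'I_n.+1 -> E -> E) (B : set E) :
    Prop :=
  [/\ common_fix L !=set0, ebounded ip B
    & exists psi : R -> R, regularity_function ip L B psi].

Definition Karamata_regular (R : realType) (E : vectType R)
    (ip : {dot E for idfun}) (L : E -> E) (B : set E) : Prop :=
  jointly_Karamata_regular ip (fun _ : 'I_1 => L) B.

(* Main.v *)
Require Import Defs.
From mathcomp Require Import all_boot all_order all_algebra.
From mathcomp Require Import all_classical all_reals all_analysis.
From mathcomp Require Import ring lra.

(* If g and f are nondecreasing with indices sigma > rho then g / f -> 0, so in a
   finite sum of nondecreasing regularly varying functions the smallest index
   dominates; under composition indices multiply. The error estimate follows by
   bounding max_i dist(x, Fix L_i) by the sum of the Gamma_i evaluated at the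
   largest residual and using the monotonicity of Phi in both variables. For the
   joint regularity, any b bounding B gives an admissible psi_B. *)

Set Implicit Arguments.
Unset Strict Implicit.
Unset Printing Implicit Defensive.

Import Order.TTheory GRing.Theory Num.Theory.
Import numFieldNormedType.Exports.

Local Open Scope classical_set_scope.
Local Open Scope ring_scope.

(** * Regular variation at zero of nondecreasing functions *)

Section RegularVariation.
Context {R : realType}.
Implicit Types (f g : R -> R) (rho sigma : R).

(** Restricted to nonnegative arguments because functions on the half-line are encoded as total
    functions with arbitrary values elsewhere. *)
Definition nondecreasing_nneg f := forall s t, 0 <= s <= t -> f s <= f t.

(** Clamping the argument at 0 gives a function monotone on the whole line, hence Borel measurable,
    and Borel sets are Caratheodory measurable. *)
Lemma nondecreasing_lebesgue_measurable f a :
  nondecreasing_nneg f -> lebesgue_measurable_fun `]0, a] f.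
Proof.
move=> ndf.
pose g x := f (Num.max 0 x).
have ndg : {homo g : x y / x <= y}.
  by move=> x y xy; apply: ndf; rewrite le_max lexx /= ge_max !le_max lexx xy orbT.
have mg : measurable_fun (`]0, a] : set (measurableTypeR R)) g.
  exact: measurable_realfun.nondecreasing_measurable.
apply: (@eq_measurable_fun _ _ _ _ _ (g : lebesgueTypeR R -> R)).
  by move=> x; rewrite inE /= in_itv /= => /andP[/ltW x0 _]; rewrite /g max_r.
move=> mD Y mY; apply: sub_caratheodory.
by apply: mg => //; exact: measurable_itv.
Qed.

Lemma at_right0_itv (P : R -> Prop) :
  (\forall x \near 0^'+, P x) -> exists2 a : R, 0 < a & forall x, 0 < x <= a -> P x.
Proof.
(* The neighbourhood is an open ball; halving its radius makes the right endpoint admissible. *)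
case=> e /= e0 He; exists (e / 2); first by rewrite divr_gt0.
move=> x /andP[x0 xe]; apply: He => //=.
rewrite sub0r normrN gtr0_norm // (le_lt_trans xe) //.
by rewrite ltr_pdivrMr // mulr2n mulrDr mulr1 ltrDl.
Qed.

Lemma RV0_near_gt0 rho f : RV0 rho f -> \forall x \near 0^'+, 0 < f x.
Proof.
case=> a a0 [fpos _ _]; near=> x; apply: fpos; apply/andP; split => //.
by near: x; exact: nbhs_right_le.
Unshelve. all: by end_near. Qed.

Lemma RV0_cvg rho f l : RV0 rho f -> 0 < l ->
  f (l * x) / f x @[x --> 0^'+] --> l `^ rho.
Proof. by case=> a a0 [_ _]; apply. Qed.

(** Monotonicity supplies the measurability, which leaves positivity near 0 and the limit of ratios
    to check. *)
Lemma nondecreasing_RV0 rho f : nondecreasing_nneg f ->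
  (\forall x \near 0^'+, 0 < f x) ->
  (forall l, 0 < l -> f (l * x) / f x @[x --> 0^'+] --> l `^ rho) -> RV0 rho f.
Proof.
move=> ndf /at_right0_itv[a a0 fpos] fcvg; exists a => //; split => //.
exact: nondecreasing_lebesgue_measurable.
Qed.

Lemma powR_continuous_pos (c theta : R) : 0 < c ->
  x `^ theta @[x --> c] --> c `^ theta.
Proof.
move=> c0; rewrite /powR (gt_eqF c0).
(* Near [c > 0] the branch of the power at 0 is avoided, so it equals [expR (theta * ln x)]. *)
apply: (@cvg_trans _ (expR (theta * ln x) @[x --> c])).
  apply: near_eq_cvg; near=> x; rewrite gt_eqF //.
  by near: x; exact: lt_nbhsr.
have cln : theta * ln x @[x --> c] --> theta * ln c.
  by apply: cvgM; [exact: cvg_cst|exact: continuous_ln].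
exact: (cvg_comp _ _ cln (@continuous_expR R _)).
Unshelve. all: by end_near. Qed.

(* On ]0, d] the ratio h = g / f satisfies h (x / 2) <= q h x with q < 1, and
   by monotonicity it is at most h d / m on [d / 2, d]; hence it decays
   geometrically along dyadic scales. *)
Lemma RV0_ratio_cvg0 rho sigma f g : rho < sigma ->
  nondecreasing_nneg f -> nondecreasing_nneg g ->
  RV0 rho f -> RV0 sigma g -> g x / f x @[x --> 0^'+] --> 0.
Proof.
move=> rs ndf ndg Rf Rg.
pose h x := g x / f x.
have half0 : (0 : R) < 2^-1 by rewrite invr_gt0.
have half1 : (2^-1 : R) < 1 by rewrite invf_lt1 // ltr1n.
(* The limit of [h (x / 2) / h x]; it is below 1 since [rho < sigma], and [q] is the midpoint of [p]
   and 1. *)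
pose p : R := 2^-1 `^ (sigma - rho).
have p0 : 0 < p by exact: powR_gt0.
have p1 : p < 1.
  rewrite /p /powR (gt_eqF half0) expR_lt1 pmulr_rlt0 ?subr_gt0 //.
  by apply: ln_lt0; rewrite half0.
pose q := (1 + p) / 2.
have q0 : 0 < q by rewrite /q; lra.
have q1 : q < 1 by rewrite /q; lra.
have pq : p < q by rewrite /q; lra.
(* Half the limit of [f (x / 2) / f x], hence a positive lower bound for this ratio near 0. *)
pose m : R := 2^-1 `^ rho / 2.
have r0 : 0 < (2^-1 : R) `^ rho by exact: powR_gt0.
have m0 : 0 < m by rewrite divr_gt0.
have mr : m < 2^-1 `^ rho by rewrite /m; lra.
have cf := RV0_cvg Rf half0.
have cg := RV0_cvg Rg half0.
have ch : (g (2^-1 * x) / g x) / (f (2^-1 * x) / f x) @[x --> 0^'+] --> p.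
  rewrite /p powRB ?(gt_eqF half0) ?implybT //.
  by apply: cvgM => //; apply: cvgV => //; rewrite (gt_eqF r0).
have [d d0 Hd] : exists2 d : R, 0 < d & forall x, 0 < x <= d ->
    [/\ 0 < f x, 0 < g x, m < f (2^-1 * x) / f x &
      (g (2^-1 * x) / g x) / (f (2^-1 * x) / f x) < q].
  apply: at_right0_itv; near=> x; split.
  - by near: x; exact: RV0_near_gt0 Rf.
  - by near: x; exact: RV0_near_gt0 Rg.
  - by near: x; exact: (cvgr_gt _ cf _ mr).
  - by near: x; exact: (cvgr_lt _ ch _ pq).
have fhalf x : 0 < x <= d -> 0 < f (2^-1 * x).
  move=> xd; case: (Hd x xd) => fx _ mf _; move: (lt_trans m0 mf).
  by rewrite pmulr_lgt0 // invr_gt0.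
have hq x : 0 < x <= d -> h (2^-1 * x) <= q * h x.
  move=> xd; have [fx gx _ hx] := Hd x xd; have f2 := fhalf x xd.
  have hx0 : 0 < h x by rewrite divr_gt0.
  rewrite -ler_pdivrMr //; apply: ltW; apply: le_lt_trans hx.
  rewrite le_eqVlt; apply/orP; left; apply/eqP; rewrite /h.
  by field; rewrite !gt_eqF // fhalf.
pose K := h d / m.
have dd : 0 < d <= d by rewrite d0 lexx.
have h0 x : 0 < x <= d -> 0 < h x.
  by move=> /Hd[? ? _ _]; rewrite divr_gt0.
have K0 : 0 < K by rewrite divr_gt0 // h0.
have hK1 y : 2^-1 * d <= y <= d -> h y <= K.
  move=> /andP[dy yd].
  have [fd gd mf _] := Hd d dd.
  have d2 : 0 <= 2^-1 * d by rewrite mulr_ge0 // ltW.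
  have y0 : 0 < y by apply: lt_le_trans dy; rewrite mulr_gt0.
  have [fy gy _ _] := Hd y (introT andP (conj y0 yd)).
  have gyd : g y <= g d by apply: ndg; rewrite yd ltW.
  have fyd : f (2^-1 * d) <= f y by apply: ndf; rewrite dy d2.
  have f2 := fhalf d dd.
  (* The worst case on [[d / 2, d]] takes the numerator at [d] and the denominator at [d / 2], where
     [f (d / 2) > m * f d]. *)
  apply: (@le_trans _ _ (g d / f (2^-1 * d))).
    by apply: ler_pM => //; rewrite ?lef_pV2 ?posrE // ?invr_ge0 ltW.
  rewrite /K /h -mulrA ler_pM2l // -invfM lef_pV2 ?posrE // ?mulr_gt0 //.
  by rewrite -ler_pdivlMl // mulrC ltW.
have half_le y n : 0 < y -> y <= 2^-1 ^+ n.+1 * d ->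
    y = 2^-1 * (2 * y) /\ 0 < 2 * y <= 2^-1 ^+ n * d.
  move=> y0 yd; split; first by rewrite mulKf.
  by rewrite mulr_gt0 //= -ler_pdivlMl // mulrA -exprS.
have le_d n : 2^-1 ^+ n * d <= d.
  by rewrite ger_pMl // exprn_ile1 ?ltW.
(* A point below [d / 2] is doubled; the factor [q < 1] lets the bound [K] pass down to every dyadic
   scale. *)
have hK n : forall y, 2^-1 ^+ n.+1 * d <= y <= d -> h y <= K.
  elim: n => [|n IH] y /andP[yl yd]; first by apply: hK1; rewrite yd andbT.
  have y0 : 0 < y by apply: lt_le_trans yl; rewrite mulr_gt0 // exprn_gt0.
  have [dy|dy] := leP (2^-1 * d) y; first by apply: hK1; rewrite dy.
  have [ey /andP[y20 y2]] := half_le y 0%N y0 (ltW dy).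
  rewrite expr0 mul1r in y2.
  have /IH hy : 2^-1 ^+ n.+1 * d <= 2 * y <= d.
    by rewrite y2 andbT -ler_pdivrMl // mulrA -exprS.
  rewrite ey (le_trans (hq _ _)) ?y20 //.
  rewrite (le_trans _ hy) // ger_pMl ?(ltW q1) // h0 // y20 //.
have cgeo (z : R) : 0 < z < 1 -> z ^+ n @[n --> \oo] --> 0.
  by move=> /andP[z0 z1]; apply: cvg_expr; rewrite gtr0_norm.
have hKall y : 0 < y <= d -> h y <= K.
  move=> /andP[y0 yd].
  have cd : 2^-1 ^+ n * d @[n --> \oo] --> 0.
    by rewrite -(mul0r d); apply: cvgM; [apply: cgeo; rewrite half0|exact: cvg_cst].
  have [N _ HN] := cvgr_lt _ cd _ y0.
  apply: (hK N); rewrite yd andbT ltW //; exact: (HN N.+1 (leqnSn _)).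
(* With [K] valid on all of []0, d]] as base case, each halving of the range gains a factor [q]. *)
have hgeo n : forall y, 0 < y <= 2^-1 ^+ n * d -> h y <= q ^+ n * K.
  elim: n => [|n IH] y; first by rewrite !expr0 !mul1r; exact: hKall.
  move=> /andP[y0 yd]; have [ey y2] := half_le y n y0 yd.
  have y2d : 0 < 2 * y <= d by case/andP: y2 => -> /le_trans ->.
  rewrite ey (le_trans (hq _ y2d)) // exprS -mulrA ler_pM2l //.
  exact: IH.
apply/cvgrPdist_le => e e0.
have cK : q ^+ n * K @[n --> \oo] --> 0.
  by rewrite -(mul0r K); apply: cvgM; [apply: cgeo; rewrite q0|exact: cvg_cst].
have [N _ HN] := cvgr_lt _ cK _ e0.
near=> x.
have xN : x <= 2^-1 ^+ N * d.
  by near: x; apply: nbhs_right_le; rewrite mulr_gt0 // exprn_gt0.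
have x0 : 0 < x by [].
have xd : 0 < x <= d by rewrite x0 (le_trans xN).
rewrite sub0r normrN gtr0_norm; last exact: h0.
apply: (le_trans (hgeo N x _)); first by rewrite x0.
exact: ltW (HN N (leqnn _)).
Unshelve. all: by end_near. Qed.

Lemma nondecreasing_nnegD f g : nondecreasing_nneg f -> nondecreasing_nneg g ->
  nondecreasing_nneg (fun x => f x + g x).
Proof. by move=> ndf ndg s t st; rewrite lerD ?ndf ?ndg. Qed.

(** With [u = g / (f + g)] in [[0, 1]] and [r] the difference of the ratios of [g] and [f], the
    ratio of the sum is [f (l * x) / f x + r x * u x]. The product [r * u] vanishes in the limit:
    for equal indices [r] tends to 0 and [u] is bounded; otherwise [r] converges and [u <= g / f]
    tends to 0. *)
Lemma RV0D_le rho sigma f g : rho <= sigma ->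
  nondecreasing_nneg f -> nondecreasing_nneg g ->
  RV0 rho f -> RV0 sigma g -> RV0 rho (fun x => f x + g x).
Proof.
move=> rs ndf ndg Rf Rg.
have posf := RV0_near_gt0 Rf; have posg := RV0_near_gt0 Rg.
apply: nondecreasing_RV0; first exact: nondecreasing_nnegD.
  by near=> x; apply: addr_gt0; near: x.
move=> l l0.
have cf := RV0_cvg Rf l0; have cg := RV0_cvg Rg l0.
pose u x := g x / (f x + g x).
pose r x := g (l * x) / g x - f (l * x) / f x.
have cr : r x @[x --> 0^'+] --> l `^ sigma - l `^ rho by exact: cvgB.
have cru : r x * u x @[x --> 0^'+] --> 0.
  move: rs; rewrite le_eqVlt => /predU1P[rs|rs].
    apply/norm_cvg0P.
    apply: (@squeeze_cvgr _ _ _ _ (fun=> 0) (fun x => `|r x|)).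
    - near=> x.
      have fx : 0 < f x by near: x.
      have gx : 0 < g x by near: x.
      rewrite normr_ge0 /= normrM ler_piMr // ger0_norm.
        by rewrite ler_pdivrMr ?addr_gt0 // mul1r lerDr ltW.
      by rewrite divr_ge0 ?addr_ge0 // ltW.
    - exact: cvg_cst.
    - by apply/norm_cvg0P; move: cr; rewrite rs subrr.
  have cu : u x @[x --> 0^'+] --> 0.
    apply: (@squeeze_cvgr _ _ _ _ (fun=> 0) (fun x => g x / f x)).
    - near=> x.
      have fx : 0 < f x by near: x.
      have gx : 0 < g x by near: x.
      rewrite divr_ge0 ?addr_ge0 ?(ltW fx) ?(ltW gx) //=.
      by rewrite ler_pM2l // lef_pV2 ?posrE ?addr_gt0 // lerDl ltW.
    - exact: cvg_cst.
    - exact: (RV0_ratio_cvg0 rs ndf ndg).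
  by have cru := cvgM cr cu; rewrite mulr0 in cru; exact: cru.
rewrite -(addr0 (l `^ rho)).
apply: (@cvg_trans _ (f (l * x) / f x + r x * u x @[x --> 0^'+]));
  last exact: cvgD.
apply: near_eq_cvg; near=> x.
have fx : 0 < f x by near: x.
have gx : 0 < g x by near: x.
by rewrite /r /u; field; rewrite !gt_eqF ?addr_gt0.
Unshelve. all: by end_near. Qed.

Lemma RV0D rho sigma f g :
  nondecreasing_nneg f -> nondecreasing_nneg g ->
  RV0 rho f -> RV0 sigma g -> RV0 (Num.min rho sigma) (fun x => f x + g x).
Proof.
move=> ndf ndg Rf Rg; have [rs|sr] := leP rho sigma; first exact: (RV0D_le rs).
have -> : (fun x => f x + g x) = (fun x => g x + f x).
  by apply/funext => x; exact: addrC.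
exact: (RV0D_le (ltW sr)).
Qed.

Lemma nondecreasing_nneg_sum n (F : 'I_n -> R -> R) :
  (forall i, nondecreasing_nneg (F i)) ->
  nondecreasing_nneg (fun x => \sum_(i < n) F i x).
Proof. by move=> ndF s t st; apply: ler_sum => i _; exact: ndF. Qed.

Lemma RV0_sum n (F : 'I_n.+1 -> R -> R) (rho : 'I_n.+1 -> R) :
  (forall i, nondecreasing_nneg (F i)) -> (forall i, RV0 (rho i) (F i)) ->
  RV0 (min_ord rho) (fun x => \sum_(i < n.+1) F i x).
Proof.
move=> ndF RF.
(* The term at [ord0] is kept apart as the base of the induction: an empty sum is zero, so not
   regularly varying, and [rho ord0] is the initial value of the minimum. *)
suff H (s : seq 'I_n.+1) :
    nondecreasing_nneg (fun x => F ord0 x + \sum_(i <- s) F i x) /\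
    RV0 (\big[Num.min/rho ord0]_(i <- s) rho i)
        (fun x => F ord0 x + \sum_(i <- s) F i x).
  have [_] := H (map (lift ord0) (index_enum 'I_n)).
  rewrite big_map => RH.
  (* [rho ord0] occurs both as initial value and as first entry; [bigmin_idl] merges the two. *)
  rewrite /min_ord big_ord_recl -bigmin_idl.
  suff -> : (fun x => \sum_(i < n.+1) F i x) =
    (fun x => F ord0 x + \sum_(i <- [seq lift ord0 i | i <- index_enum 'I_n]) F i x) by [].
  by apply/funext => x; rewrite big_ord_recl big_map.
elim: s => [|i s [IHn IHR]].
  rewrite big_nil; have -> // : (fun x => F ord0 x + \sum_(i <- [::]) F i x) = F ord0.
  by apply/funext => x; rewrite big_nil addr0.
have -> : (fun x => F ord0 x + \sum_(j <- i :: s) F j x) =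
    (fun x => F i x + (F ord0 x + \sum_(j <- s) F j x)).
  by apply/funext => x; rewrite big_cons addrCA.
rewrite big_cons; split; first exact: nondecreasing_nnegD.
exact: RV0D.
Qed.

(** Positivity turns a limit 0 into a limit from the right, so that [f] can be substituted into
    limits at [0^'+]. *)
Lemma cvg_at_right0_gt0 f : f x @[x --> 0^'+] --> 0 ->
  (\forall x \near 0^'+, 0 < f x) -> f x @[x --> 0^'+] --> 0^'+.
Proof.
move=> cf posf P [e /= e0 He].
have ce : \forall x \near 0^'+, `|f x| < e by exact: cvgr0_norm_lt.
rewrite /fmap /= nbhs_simpl /=; near=> x; apply: He => /=; last by near: x.
by rewrite sub0r normrN; near: x.
Unshelve. all: by end_near. Qed.

(* Since f is nondecreasing, f (g (l x)) is squeezed between the values of f at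
   (l^rho - d) g x and (l^rho + d) g x, so that pointwise regular variation of f
   suffices and no uniform convergence theorem is needed. *)
Lemma RV0_comp theta rho f g :
  nondecreasing_nneg f -> nondecreasing_nneg g ->
  (forall x, 0 <= x -> 0 <= g x) ->
  g x @[x --> 0^'+] --> 0 ->
  RV0 theta f -> RV0 rho g -> RV0 (theta * rho) (f \o g).
Proof.
move=> ndf ndg g0 cg0 Rf Rg.
have posf := RV0_near_gt0 Rf; have posg := RV0_near_gt0 Rg.
have cg := cvg_at_right0_gt0 cg0 posg.
have posfg : \forall x \near 0^'+, 0 < f (g x) by exact: cg posf.
apply: nondecreasing_RV0 => //.
  by move=> s t st; apply/ndf; rewrite ndg // g0 //; case/andP: st.
move=> l l0; rewrite mulrC powRrM.
set c := l `^ rho; have c0 : 0 < c by exact: powR_gt0.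
apply/cvgrPdist_le => e e0.
have e20 : 0 < e / 2 by rewrite divr_gt0.
have /cvgrPdist_le/(_ _ e20)/nbhs_ballP[d /= d0 Hd] := @powR_continuous_pos c theta c0.
(* Both [c - d'] and [c + d'] lie in the ball where the power is within [e / 2] of its value at [c],
   and [c - d'] stays positive, so the limit for [f] applies with either factor. *)
pose d' := Num.min (d / 2) (c / 2).
have d'0 : 0 < d' by rewrite lt_min !divr_gt0.
have d'd : d' < d by rewrite gt_min; apply/orP; left; lra.
have d'c : d' < c by rewrite gt_min; apply/orP; right; lra.
have c10 : 0 < c - d' by rewrite subr_gt0.
have c20 : 0 < c + d' by rewrite addr_gt0.
have /Hd H1 : ball c d (c - d').
  by rewrite /ball /= opprB addrC subrK gtr0_norm.
have /Hd H2 : ball c d (c + d').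
  by rewrite /ball /= opprD addNKr normrN gtr0_norm.
have comp k : 0 < k -> f (k * g x) / f (g x) @[x --> 0^'+] --> k `^ theta.
  by move=> k0; exact: (cvg_comp _ _ cg (RV0_cvg Rf k0)).
have /cvgrPdist_le/(_ _ e20) near1 := comp _ c10.
have /cvgrPdist_le/(_ _ e20) near2 := comp _ c20.
have /cvgrPdist_le/(_ _ d'0) nearg := RV0_cvg Rg l0.
near=> x.
have gx : 0 < g x by near: x.
have fgx : 0 < f (g x) by near: x.
have : `|c - g (l * x) / g x| <= d' by near: x.
rewrite ler_distlC => /andP[].
rewrite ler_pdivlMr // ler_pdivrMr // => g1 g2.
have f1 : f ((c - d') * g x) <= f (g (l * x)).
  by apply: ndf; rewrite g1 mulr_ge0 // ltW.
have f2 : f (g (l * x)) <= f ((c + d') * g x).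
  by apply: ndf; rewrite g2 g0 // mulr_ge0 // ltW.
have : `|(c - d') `^ theta - f ((c - d') * g x) / f (g x)| <= e / 2 by near: x.
have : `|(c + d') `^ theta - f ((c + d') * g x) / f (g x)| <= e / 2 by near: x.
have r1 : f ((c - d') * g x) / f (g x) <= f (g (l * x)) / f (g x).
  by rewrite ler_pM2r // invr_gt0.
have r2 : f (g (l * x)) / f (g x) <= f ((c + d') * g x) / f (g x).
  by rewrite ler_pM2r // invr_gt0.
(* One [e / 2] comes from continuity of the power, the other from regular variation of [f]. *)
move: H1 H2; rewrite /= !ler_distl => /andP[? ?] /andP[? ?] /andP[? ?] /andP[? ?].
by apply/andP; split; lra.
Unshelve. all: by end_near. Qed.

End RegularVariation.

(** * Bounds for finite maxima and minima *)

Lemma le_max_ord (R : realType) n (f : 'I_n.+1 -> R) i : f i <= max_ord f.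
Proof. exact: le_bigmax. Qed.

Lemma max_ord_le (R : realType) n (f : 'I_n.+1 -> R) (M : R) :
  (forall i, f i <= M) -> max_ord f <= M.
Proof. by move=> fM; exact: bigmax_le. Qed.

Lemma min_ord_le (R : realType) n (f : 'I_n.+1 -> R) i : min_ord f <= f i.
Proof. exact: bigmin_inf. Qed.

Lemma le_min_ord (R : realType) n (f : 'I_n.+1 -> R) (m : R) :
  (forall i, m <= f i) -> m <= min_ord f.
Proof. by move=> mf; exact: le_bigmin. Qed.

(** * Distances and regularity functions of a single operator *)

Section ErrorBound.
Context {R : realType} {E : vectType R} (ip : {dot E for idfun}).

Lemma enorm_ge0 (x : E) : 0 <= enorm ip x.
Proof. exact: sqrtr_ge0. Qed.

Lemma dist_to_ge0 (x : E) (C : set E) : 0 <= dist_to ip x C.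
Proof.
rewrite /dist_to; have [->|C0] := eqVneq C set0; first by rewrite image_set0 inf0.
have /set0P[y Cy] := C0.
apply: lb_le_inf; first by exists (enorm ip (x - y)), y.
by move=> _ [z _ <-]; exact: enorm_ge0.
Qed.

(** Over ['I_1] the maximum and the intersection each collapse to their only member. *)
Lemma regularity_function1 (L : E -> E) (B : set E) (psi : R -> R) :
  regularity_function ip (fun _ : 'I_1 => L) B psi ->
  forall x, B x -> dist_to ip x (fixed_points L) <= psi (enorm ip (x - L x)).
Proof.
case=> _ + _ _ _ x Bx => /(_ x Bx).
rewrite /max_ord big_ord_recl big_ord0 maxxx.
suff -> : common_fix (fun _ : 'I_1 => L) = fixed_points L by [].
by apply/seteqP; split=> y; [move=> /(_ ord0 I)|move=> Ly i _].
Qed.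

(** * The composite regularity function *)

Section Joint.
Context (n : nat) (L : 'I_n.+1 -> E -> E) (Phi : R -> R -> R) (B : set E).
Context (Phi_bound : consistent_error_bound ip (fun i => fixed_points (L i)) Phi).
Context (Gamma : 'I_n.+1 -> R -> R) (b : R).
Context (b_gt0 : 0 < b).
Context (B_sub : B `<=` [set x | enorm ip x <= b]).
Context (Gamma_reg : forall i, regularity_function ip (fun _ : 'I_1 => L i) B (Gamma i)).

Let GammaB t := \sum_(i < n.+1) Gamma i t.
Let psiB t := Phi (GammaB t) b.

Lemma sum_regularity_ge0 t : 0 <= t -> 0 <= GammaB t.
Proof.
by move=> t0; apply: sumr_ge0 => i _; case: (Gamma_reg i) => + _ _ _ _; exact.
Qed.

Lemma sum_regularity_nondecreasing : nondecreasing_nneg GammaB.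
Proof. by apply: nondecreasing_nneg_sum => i; case: (Gamma_reg i). Qed.

Lemma sum_regularity_cvg0 : GammaB t @[t --> 0^'+] --> 0.
Proof.
have : \sum_(i < n.+1) Gamma i t @[t --> 0^'+] --> \sum_(i < n.+1) (0 : R).
  apply: cvg_big => [|i _]; last by case: (Gamma_reg i) => _ _ _ [].
  exact: add_continuous.
by rewrite big1.
Qed.

Lemma composite_error_bound x : B x ->
  dist_to ip x (common_fix L) <= psiB (max_ord (fun i => enorm ip (x - L i x))).
Proof.
move=> Bx; case: Phi_bound => _ Phi_ndl Phi_ndr _ Phi_dist.
set M := max_ord _.
have M0 : 0 <= M by exact: le_trans (enorm_ge0 _) (le_max_ord _ ord0).
have D0 : 0 <= max_ord (fun i => dist_to ip x (fixed_points (L i))).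
  exact: le_trans (dist_to_ge0 x _) (le_max_ord _ ord0).
apply: le_trans (Phi_dist x) _.
(* The first argument is enlarged to [GammaB M] before the second is enlarged to [b]. Each distance
   is at most [Gamma i M], and the other summands are nonnegative. *)
apply: (@le_trans _ _ (Phi (GammaB M) (enorm ip x))).
  apply: Phi_ndl; last exact: enorm_ge0.
  rewrite D0; apply: max_ord_le => i.
  apply: le_trans (regularity_function1 (Gamma_reg i) Bx) _.
  apply: (@le_trans _ _ (Gamma i M)).
    case: (Gamma_reg i) => _ _ nd _ _; apply: nd; rewrite enorm_ge0.
    exact: (le_max_ord (fun i => enorm ip (x - L i x))).
  rewrite /GammaB (bigD1 i) //= lerDl; apply: sumr_ge0 => j _.
  by case: (Gamma_reg j) => + _ _ _ _; exact.
apply: Phi_ndr; first exact: sum_regularity_ge0.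
by rewrite enorm_ge0; exact: B_sub.
Qed.

Lemma Phi_nondecreasing : nondecreasing_nneg (Phi ^~ b).
Proof. by case: Phi_bound => _ nd _ _ _ s t st; apply: nd => //; exact: ltW. Qed.

Lemma composite_RV0 (rho : 'I_n.+1 -> R) (theta : R) :
  (forall i, RV0 (rho i) (Gamma i)) -> RV0 theta (Phi ^~ b) ->
  RV0 (theta * min_ord rho) psiB.
Proof.
move=> RG RPhi; apply: (RV0_comp Phi_nondecreasing) => //.
- exact: sum_regularity_nondecreasing.
- exact: sum_regularity_ge0.
- exact: sum_regularity_cvg0.
- by apply: RV0_sum => // i; case: (Gamma_reg i).
Qed.

Lemma composite_regularity_function (rho : 'I_n.+1 -> R) (theta : R) :
  (forall i, 0 <= rho i <= 1) -> (forall i, RV0 (rho i) (Gamma i)) ->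
  0 <= theta <= 1 -> RV0 theta (Phi ^~ b) ->
  regularity_function ip L B psiB.
Proof.
move=> rho01 RG /andP[theta0 theta1] RPhi.
have [Phi_ge0 _ _ /(_ b (ltW b_gt0))[Phi_cvg Phi0] _] := Phi_bound.
(* Needed for [GammaB] to approach 0 from the right, as the limit of [Phi ^~ b] is one-sided. *)
have posG : \forall t \near 0^'+, 0 < GammaB t.
  apply: (@RV0_near_gt0 _ (min_ord rho)); apply: RV0_sum => // i.
  by case: (Gamma_reg i).
split.
- by move=> t t0; apply: Phi_ge0; [exact: sum_regularity_ge0|exact: ltW].
- exact: composite_error_bound.
- move=> s t st; apply: Phi_nondecreasing.
  rewrite sum_regularity_nondecreasing // sum_regularity_ge0 //.
  by case/andP: st.
- split; first exact: (cvg_comp _ _ (cvg_at_right0_gt0 sum_regularity_cvg0 posG) Phi_cvg).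
  rewrite /psiB /GammaB big1 // => i _.
  by case: (Gamma_reg i) => _ _ _ [].
exists (theta * min_ord rho); last exact: composite_RV0.
have min0 : 0 <= min_ord rho by apply: le_min_ord => i; case/andP: (rho01 i).
rewrite mulr_ge0 //= mulr_ile1 //.
by apply: le_trans (min_ord_le _ ord0) _; case/andP: (rho01 ord0).
Qed.

End Joint.
End ErrorBound.

(** * Joint Karamata regularity and the index of the composite *)

Theorem proposition3p4 (R : realType) (E : vectType R)
    (ip : {dot E for idfun}) (n : nat) (L : 'I_n.+1 -> E -> E)
    (Phi : R -> R -> R) (B : set E)
    (hLne : forall i, nonexpansive ip (L i))
    (hLcl : forall i, closed_operator ip (L i))
    (hfix : common_fix L !=set0)
    (hPhi : consistent_error_bound ip (fun i => fixed_points (L i)) Phi)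
    (hB : ebounded ip B)
    (hi : forall b : R, 0 < b ->
       exists2 theta : R, 0 <= theta <= 1 & RV0 theta (fun t => Phi t b))
    (hii : forall i, Karamata_regular ip (L i) B) :
  jointly_Karamata_regular ip L B
  /\
  (forall (Gamma : 'I_n.+1 -> R -> R) (rho : 'I_n.+1 -> R) (b theta_b : R),
     (forall i, regularity_function ip (fun _ : 'I_1 => L i) B (Gamma i)) ->
     (forall i, RV0 (rho i) (Gamma i)) ->
     0 < b ->
     B `<=` [set x | enorm ip x <= b] ->
     0 <= theta_b <= 1 ->
     RV0 theta_b (fun t => Phi t b) ->
     let Theta_B := fun t => Phi t b in
     let Gamma_B := fun t => \sum_(i < n.+1) Gamma i t in
     let psi_B := Theta_B \o Gamma_B in
     (forall x, B x ->
        dist_to ip x (common_fix L) <=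
          psi_B (max_ord (fun i => enorm ip (x - L i x)))) /\
     RV0 (theta_b * min_ord rho) psi_B).
Proof.
split; last first.
  move=> Gamma rho b theta hGamma hrho b0 hBb _ hPhib /=; split.
    exact: (composite_error_bound hPhi hBb hGamma).
  exact: (composite_RV0 hPhi b0 hGamma).
split=> //; have [M hM] := hB.
(* The bound [M] may be nonpositive, for instance when [B] is empty, while [hi] asks for a positive
   radius. *)
pose b := Num.max M 1.
have b0 : 0 < b by rewrite lt_max ltr01 orbT.
have hBb : B `<=` [set x | enorm ip x <= b].
  by move=> x /hM /= xM; rewrite le_max xM.
have [theta theta01 hPhib] := hi b b0.
have /choice[Gamma hGamma] : forall i, exists psi : R -> R,
    regularity_function ip (fun _ : 'I_1 => L i) B psi.
  by move=> i; case: (hii i).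
(* The indices are those carried by the chosen regularity functions, which places them in
   [[0, 1]]. *)
have /choice[rho hrho] : forall i, exists rho : R, 0 <= rho <= 1 /\ RV0 rho (Gamma i).
  by move=> i; case: (hGamma i) => _ _ _ _ [r r01 Rr]; exists r.
exists (fun t => Phi (\sum_(i < n.+1) Gamma i t) b).
by apply: (composite_regularity_function hPhi b0 hBb hGamma (rho := rho) (theta := theta)) => // i;
  case: (hrho i).
Qed.
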